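(* Let $k\in\mathbb{N}_0$ and suppose there is $s\ge 2$ such that for every $g\in H^k(\Omega)$ the weak solution $Tg$ of the biharmonic problem lies in $H^s(\Omega)$ and $\|Tg\|_s\le C\|g\|_k$ with $C>0$ independent of $g$. Suppose there are operators $I_h\in L(V,V_h)$ and $E_h\in L(V_h,V)$ and non-negative parameters $\delta_1(s),\delta_2,\delta_4$ such that (P1) $\sup\{\|v-I_hv\|_h : v\in V\cap H^s(\Omega),\ \|v\|_s=1\}=\delta_1(s)$; (P2)(a) $\|v_h-E_hv_h\|\le \delta_2\,\mathrm{dist}(v_h,V)$ for all $v_h\in V_h$; (P2)(c) $\sup\{|a_h(v_h-E_hv_h,\chi)| : v_h\in V_h,\ \|v_h\|_h=1,\ \chi\in V\cap H^s(\Omega),\ \|\chi\|_s=1\}=\delta_4$. Set $\beta(s):=\delta_1(s)+\delta_2+\delta_4$. Then there exists a constant $C>0$, independent of $f$ and $h$, such that for every $f\in H^k(\Omega)$ $$\|Tf-T_hf\|_h\le C\,\beta(s)\,\|f\|_k .$$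
   Context: $\Omega\subset\mathbb{R}^2$ is a bounded domain with Lipschitz boundary; $\mathbb{N}_0=\mathbb{N}\cup\{0\}$; $\|\cdot\|_t$ is the $H^t(\Omega)$ norm, $(\cdot,\cdot)$ and $\|\cdot\|$ are the $L^2(\Omega)$ inner product and norm. $V:=H^2_0(\Omega)$, $V':=H^{-2}(\Omega)$, and $a(v,w):=\int_\Omega\Delta v\,\Delta w\,dx$ on $V\times V$ (continuous and coercive). $T:V'\to L^2(\Omega)$ is the solution operator: $Tf\in V$ is the unique solution of $a(Tf,v)=\langle f,v\rangle$ for all $v\in V$ (with $\langle f,v\rangle=(f,v)$ if $f\in L^2(\Omega)$). $V_h$ is a finite element space of piecewise polynomials (degree at most $p$) on a partition of $\Omega$ with mesh size $h$, not necessarily contained in $V$. $a_h:(V+V_h)\times(V+V_h)\to\mathbb{R}$ is a symmetric bilinear form, bounded with respect to a norm $\|\cdot\|_h$ on $V+V_h$, coercive on $V_h$ with respect to $\|\cdot\|_h$ (constants independent of $h$), with $a_h=a$ on $V\times V$. $T_h:L^2(\Omega)\to L^2(\Omega)$ is the discrete solution operator: $T_hf\in V_h$ is the unique solution of $a_h(T_hf,v_h)=(f,v_h)$ for all $v_h\in V_h$; it satisfies $\|T_hf\|_h\le C\|f\|$ with $C$ independent of $f$ and $h$. $L(X,Y)$ denotes linear operators from $X$ to $Y$. $\mathrm{dist}(v_h,V):=\inf_{v\in V}\|v_h-v\|_h$. The parameters $\delta_i$ may depend on $h$. *)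

(* Defs.v *)
From HB Require Import structures.
From mathcomp Require Import all_boot all_order all_algebra.
From mathcomp Require Import all_classical all_reals all_analysis.
Set Implicit Arguments. Unset Strict Implicit. Unset Printing Implicit Defensive.
Import Order.TTheory GRing.Theory Num.Theory.
Import numFieldNormedType.Exports.
Local Open Scope classical_set_scope.
Local Open Scope ring_scope.

Notation plane R := (R * R)%type.

(* A function on a domain Om is represented by a function on the whole plane
   whose values outside Om are never used; elements of L^2(Om) and of the
   Sobolev spaces are identified through [ae_eq plane_mu Om], never through
   Leibniz equality. *)
Section Sobolev.
Context {R : realType}.
Implicit Types (Om K : set (plane R)) (u v w f g phi : plane R -> R).

Definition plane_mu := (@lebesgue_measure R \x @lebesgue_measure R)%E.

Definition edist (x y : plane R) : R :=
  Num.sqrt ((x.1 - y.1) ^+ 2 + (x.2 - y.2) ^+ 2).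

(* Near each boundary point, in suitably rotated Cartesian coordinates, Om is
   the region strictly above the graph of a Lipschitz function. *)
Definition lipschitz_boundary Om : Prop :=
  forall x, (closure Om `\` Om) x ->
  exists c s r L : R, exists gamma : R -> R,
  [/\ c ^+ 2 + s ^+ 2 = 1, 0 < r,
      (forall a b, `|gamma a - gamma b| <= L * `|a - b|) &
      forall y, edist x y < r ->
        (Om y <-> gamma (c * y.1 + s * y.2) < - s * y.1 + c * y.2)].

Definition bounded_lipschitz_domain Om : Prop :=
  [/\ open Om, connected Om, Om !=set0, bounded_set Om & lipschitz_boundary Om].

Definition L2norm Om f : \bar R := 'N[plane_mu]_2%:E[EFin \o (f \_ Om)]%E.

Definition L2 Om : set (plane R -> R) :=
  [set f | (f \_ Om) \in Lfun plane_mu 2%:E].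

Definition L2inner Om f g : R := \int[plane_mu]_(x in Om) (f x * g x).

Definition d1 phi : plane R -> R := 'D_((1, 0) : plane R) phi.
Definition d2 phi : plane R -> R := 'D_((0, 1) : plane R) phi.
Definition dpartial (i j : nat) phi : plane R -> R := iter i d1 (iter j d2 phi).

(* A word in {true, false} is an iterated partial derivative, in any order. *)
Definition smooth phi : Prop := forall (l : seq bool) (x : plane R),
  differentiable (foldr (fun b : bool => if b then d1 else d2) phi l) x.

Definition test_function Om phi : Prop :=
  [/\ smooth phi, compact (closure [set x | phi x != 0]) &
      closure [set x | phi x != 0] `<=` Om].

Definition weak_derivative Om (i j : nat) v g : Prop :=
  forall phi, test_function Om phi ->
  L2inner Om v (dpartial i j phi) = (-1) ^+ (i + j) * L2inner Om g phi.

(* [g i j] is the derivative of order (i, j) of v, for i + j <= m. *)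
Definition weak_derivatives Om (m : nat) v (g : nat -> nat -> plane R -> R) :=
  g 0 0 = v /\ forall i j, (i + j <= m)%N ->
    L2 Om (g i j) /\ weak_derivative Om i j v (g i j).

(* Square of the Sobolev-Slobodeckij (Gagliardo) seminorm of order sigma in
   (0,1), in dimension 2. *)
Definition slobodeckij_sqr Om (sigma : R) w : \bar R :=
  (\int[plane_mu \x plane_mu]_(z in Om `*` Om)
    ((w z.1 - w z.2) ^+ 2 / edist z.1 z.2 `^ (2 + 2 * sigma))%:E)%E.

Definition sobolev_sqr Om (t : R) (g : nat -> nat -> plane R -> R) : \bar R :=
  let m := Num.truncn t in
  (\sum_(i < m.+1) \sum_(j < m.+1 | (i + j <= m)%N) L2norm Om (g i j) ^+ 2 +
   (if t == m%:R then 0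
    else \sum_(i < m.+1) slobodeckij_sqr Om (t - m%:R) (g i (m - i)%N)))%E.

(* H^t norm for real t >= 0. Weak derivatives are unique almost everywhere, so
   the infimum ranges over at most one value; it is +oo if some weak derivative
   of order at most the integer part of t is missing. *)
Definition sobolev_norm Om (t : R) v : \bar R :=
  ereal_inf [set N | exists2 g, weak_derivatives Om (Num.truncn t) v g &
                                N = sqrte (sobolev_sqr Om t g)].

Definition sobolev Om (t : R) : set (plane R -> R) :=
  [set v | (sobolev_norm Om t v < +oo)%E].

(* H^2_0(Om): closure of the test functions in H^2(Om). *)
Definition H20 Om : set (plane R -> R) :=
  [set v | sobolev Om 2 v /\ forall e : R, 0 < e ->
    exists2 phi, test_function Om phi & (sobolev_norm Om 2 (v - phi)%R < e%:E)%E].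

(* H^{-2}(Om): bounded linear functionals on H^2_0(Om). *)
Definition Hm2 Om : set ((plane R -> R) -> R) :=
  [set F | (forall (c : R) u v, H20 Om u -> H20 Om v ->
              F (c *: u + v) = c * F u + F v) /\
           exists C : R, forall v, H20 Om v ->
              (`|F v|%:E <= C%:E * sobolev_norm Om 2 v)%E].

(* Some representative of the weak derivative, which is unique almost
   everywhere when it exists. *)
Definition wderiv Om (i j : nat) v : plane R -> R :=
  xget 0 [set g | L2 Om g /\ weak_derivative Om i j v g].

Definition laplacian Om v : plane R -> R := wderiv Om 2 0 v + wderiv Om 0 2 v.

Definition biharmonic_form Om v w : R :=
  L2inner Om (laplacian Om v) (laplacian Om w).

(* T : H^{-2}(Om) -> H^2_0(Om); a right-hand side f in L^2(Om) enters as the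
   functional [L2inner Om f]. *)
Definition solution_operator Om (T : ((plane R -> R) -> R) -> plane R -> R) :=
  forall F, Hm2 Om F ->
  [/\ H20 Om (T F),
      (forall v, H20 Om v -> biharmonic_form Om (T F) v = F v) &
      forall u, H20 Om u ->
        (forall v, H20 Om v -> biharmonic_form Om u v = F v) ->
        ae_eq plane_mu Om u (T F)].

End Sobolev.

Section Discretization.
Context {R : realType}.
Implicit Types (Om : set (plane R)) (X Y W Vh : set (plane R -> R)).

Definition subspace X : Prop :=
  X 0 /\ forall (c : R) u v, X u -> X v -> X (c *: u + v).

Definition linear_operator Om X Y (A : (plane R -> R) -> plane R -> R) : Prop :=
  [/\ (forall u, X u -> Y (A u)),
      (forall u v, X u -> X v -> ae_eq plane_mu Om u v ->
         ae_eq plane_mu Om (A u) (A v)) &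
      forall (c : R) u v, X u -> X v ->
        ae_eq plane_mu Om (A (c *: u + v)) (c *: A u + A v)].

Definition set_sum X Y : set (plane R -> R) :=
  [set f | exists u v, [/\ X u, Y v & f = u + v]].

Definition norm_on Om W (N : (plane R -> R) -> R) : Prop :=
  [/\ (forall v, W v -> 0 <= N v),
      (forall v, W v -> (N v = 0 <-> ae_eq plane_mu Om v 0)),
      (forall (c : R) v, W v -> N (c *: v) = `|c| * N v) &
      forall u v, W u -> W v -> N (u + v) <= N u + N v].

Definition symmetric_bilinear_on W (b : (plane R -> R) -> (plane R -> R) -> R) :=
  (forall u v, W u -> W v -> b u v = b v u) /\
  (forall (c : R) u v w, W u -> W v -> W w ->
     b (c *: u + v) w = c * b u w + b v w).

(* The elements are open, so that the partition covers Om up to the null set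
   formed by the element boundaries. *)
Definition partition_of Om (P : set (set (plane R))) : Prop :=
  [/\ finite_set P, (forall K, P K -> [/\ open K, K !=set0 & K `<=` Om]),
      trivIset P id & plane_mu.-negligible (Om `\` \bigcup_(K in P) K)].

Definition mesh_size (P : set (set (plane R))) : R :=
  sup [set d | exists K x y, [/\ P K, K x, K y & d = edist x y]].

Definition polynomial_on (p : nat) (K : set (plane R)) (v : plane R -> R) :=
  exists c : nat -> nat -> R, forall x, K x ->
    v x = \sum_(i < p.+1) \sum_(j < p.+1 | (i + j <= p)%N)
            c i j * x.1 ^+ i * x.2 ^+ j.

Definition finite_element_space Om (p : nat) (P : set (set (plane R))) Vh :=
  [/\ subspace Vh, Vh `<=` L2 Om &
      forall v, Vh v -> forall K, P K -> polynomial_on p K v].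

(* Th is the solution operator of the discrete problem on Vh. *)
Definition discrete_solution_operator Om Vh
    (ah : (plane R -> R) -> (plane R -> R) -> R)
    (Th : (plane R -> R) -> plane R -> R) : Prop :=
  forall f, L2 Om f ->
  [/\ Vh (Th f), (forall v, Vh v -> ah (Th f) v = L2inner Om f v) &
      forall u, Vh u -> (forall v, Vh v -> ah u v = L2inner Om f v) ->
        ae_eq plane_mu Om u (Th f)].

(* The discretizations are indexed by their mesh size h in Hs; the constants
   M, alpha and Cst do not depend on h. *)
Record discretization Om (p : nat) (Hs : set R)
    (Ph : R -> set (set (plane R))) (Vh : R -> set (plane R -> R))
    (ah : R -> (plane R -> R) -> (plane R -> R) -> R)
    (nh : R -> (plane R -> R) -> R)
    (Th : R -> (plane R -> R) -> plane R -> R) : Prop := {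
  disc_partition : forall h, Hs h -> partition_of Om (Ph h);
  disc_mesh_size : forall h, Hs h -> 0 < h /\ mesh_size (Ph h) = h;
  disc_space : forall h, Hs h -> finite_element_space Om p (Ph h) (Vh h);
  disc_norm : forall h, Hs h -> norm_on Om (set_sum (H20 Om) (Vh h)) (nh h);
  disc_form : forall h, Hs h ->
    symmetric_bilinear_on (set_sum (H20 Om) (Vh h)) (ah h);
  disc_bounded : exists2 M : R, 0 < M & forall h, Hs h -> forall u v,
    set_sum (H20 Om) (Vh h) u -> set_sum (H20 Om) (Vh h) v ->
    `|ah h u v| <= M * nh h u * nh h v;
  disc_coercive : exists2 alpha : R, 0 < alpha & forall h, Hs h ->
    forall v, Vh h v -> alpha * nh h v ^+ 2 <= ah h v v;
  disc_conforming : forall h, Hs h -> forall u v, H20 Om u -> H20 Om v ->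
    ah h u v = biharmonic_form Om u v;
  disc_solution : forall h, Hs h ->
    discrete_solution_operator Om (Vh h) (ah h) (Th h);
  disc_stable : exists2 Cst : R, 0 < Cst & forall h, Hs h -> forall f, L2 Om f ->
    ((nh h (Th h f))%:E <= Cst%:E * L2norm Om f)%E }.

Definition dist_to (N : (plane R -> R) -> R) X (w : plane R -> R) : R :=
  inf [set N (w - v) | v in X].

(* Supremum in [0, +oo] of a set of nonnegative quantities, 0 if it is empty
   (which happens below for the zero discrete space). *)
Definition sup_nneg (S : set R) : \bar R :=
  maxe 0%:E (ereal_sup [set x%:E | x in S]).

End Discretization.

(* Main.v *)
(* Strang-type argument. Put u = Tf, u_h = T_h f and w = I_h u - u_h. Coercivity
   bounds alpha |w|_h^2 by a_h(w, w), and testing with the conforming function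
   E_h w gives
     a_h(w, w) = - a_h(u - I_h u, w) + a_h(w - E_h w, u) + (f, E_h w - w).
   The three terms are controlled by delta_1, delta_4 and delta_2 respectively
   (with dist(w, V) <= |w|_h), and |u|_s, |f| are bounded by |f|_k. *)
Require Import Defs.
From HB Require Import structures.
From mathcomp Require Import all_boot all_order all_algebra.
From mathcomp Require Import all_classical all_reals all_analysis.
From mathcomp Require Import measurable_realfun.
From mathcomp Require Import ring.
Set Implicit Arguments. Unset Strict Implicit. Unset Printing Implicit Defensive.
Import Order.TTheory GRing.Theory Num.Theory.
Import numFieldNormedType.Exports.
Local Open Scope classical_set_scope.
Local Open Scope ring_scope.

(** * Homogeneity and vanishing of integrals of arbitrary functions *)

(* Products with derivatives of test functions and Slobodeckij integrands are
   scaled below without a proof that they are measurable, so the integral is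
   treated directly as a supremum over simple functions. *)
Section UnmeasurableIntegrals.
Local Open Scope ereal_scope.
Context d (T : measurableType d) (R : realType).
Variable mu : {measure set T -> \bar R}.
Implicit Types (D : set T) (f : T -> \bar R).
Import HBNNSimple.

(** A simple function below [k f] becomes, after division by [k], a simple function below [f]; this
    gives one inequality. The same inequality for the factor [c^-1] and the function [c f] is the
    converse. *)
Lemma ge0_integral_scale_pos (c : R) f : (0 < c)%R -> (forall x, 0 <= f x) ->
  \int[mu]_x (c%:E * f x) = c%:E * \int[mu]_x f x.
Proof.
have half (k : R) g : (0 < k)%R -> (forall x, 0 <= g x) ->
    \int[mu]_x (k%:E * g x) <= k%:E * \int[mu]_x g x.
  move=> k0 g0; rewrite ge0_integralTE; last first.
    by move=> x; rewrite mule_ge0 // lee_fin ltW.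
  apply/ge_ereal_sup => _ [h /= hg <-].
  have ki0 : (0 <= k^-1)%R by rewrite invr_ge0 ltW.
  rewrite -[leLHS]mul1e -(divff (lt0r_neq0 k0)) EFinM -muleA.
  rewrite lee_pmul2l// ?lte_fin// -sintegralrM ge0_integralTE//.
  apply: ereal_sup_ubound; exists (scale_nnsfun h ki0) => //= x.
  by rewrite EFinM lee_pdivrMl.
move=> c0 f0; apply/eqP; rewrite eq_le half //=.
have ci0 : (0 < c^-1)%R by rewrite invr_gt0.
have cf0 x : 0 <= c%:E * f x by rewrite mule_ge0 // lee_fin ltW.
have := half c^-1%R (fun x => c%:E * f x) ci0 cf0.
rewrite lee_pdivlMl//.
by under eq_integral do rewrite muleA -EFinM mulVf ?gt_eqF// mul1e.
Qed.

Lemma ge0_integral_scale (c : R) D f : (0 <= c)%R ->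
  (forall x, D x -> 0 <= f x) ->
  \int[mu]_(x in D) (c%:E * f x) = c%:E * \int[mu]_(x in D) f x.
Proof.
rewrite le_eqVlt => /predU1P[<- _|c0 f0].
  by under eq_integral do rewrite mul0e; rewrite integral0 mul0e.
rewrite integral_mkcond [in RHS]integral_mkcond -ge0_integral_scale_pos//.
  by rewrite erestrict_scale.
exact: erestrict_ge0.
Qed.

(** A nonnegative factor scales the positive and negative parts separately, and a change of sign
    exchanges them. Infinite parts do no harm, because [fine] sends both infinities to 0. *)
Lemma Rintegral_scale (c : R) D (f : T -> R) :
  (\int[mu]_(x in D) (c * f x) = c * \int[mu]_(x in D) f x)%R.
Proof.
(* Two equal infinities subtract to [-oo] in either order, and [fine] turns this into 0, so
   antisymmetry survives. *)
have fineB' (a b : \bar R) : fine (b - a) = (- fine (a - b))%R.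
  by case: a b => [a| |] [b| |] //=; rewrite ?oppr0// opprB.
have pos (k : R) : (0 <= k)%R ->
    (\int[mu]_(x in D) (k * f x) = k * \int[mu]_(x in D) f x)%R.
  move=> k0; rewrite /Rintegral integralE [in RHS]integralE.
  have -> : (fun x => (k * f x)%:E) = (fun x => k%:E * (EFin \o f) x) by [].
  rewrite ge0_funeposM// ge0_funenegM// !ge0_integral_scale//.
  set a := integral _ _ _; set b := integral _ _ _.
  have [->|kn0] := eqVneq k 0%R; first by rewrite !mul0e mul0r subee.
  have {kn0}k0' : (0 < k)%R by rewrite lt_neqAle eq_sym kn0.
  case: a => [a| |]; case: b => [b| |];
    rewrite ?gt0_muley ?gt0_muleNy ?lte_fin//= ?mulr0//; last by rewrite mulrBr.
have neg g : (\int[mu]_(x in D) - g x = - \int[mu]_(x in D) g x)%R.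
  rewrite /Rintegral integralE [in RHS]integralE.
  have -> : (fun x => (- g x)%:E) = \- (EFin \o g) by [].
  by rewrite funeposN funenegN fineB'.
have [/pos//|c0] := leP 0%R c.
rewrite -[c in RHS]opprK mulNr -pos ?oppr_ge0 ?ltW// -neg.
by apply: eq_Rintegral => x _; rewrite mulNr opprK.
Qed.

(** A nonnegative simple function below a null function is itself null, and being measurable it has
    integral 0; the supremum over such functions is then 0. Positive and negative parts reduce the
    general case to this one. *)
Lemma integral_ae0 D f : ae_eq mu D f (cst 0) -> \int[mu]_(x in D) f x = 0.
Proof.
have ge0 g : (forall x, 0 <= g x) -> (\forall x \ae mu, g x = 0) ->
    \int[mu]_x g x = 0.
  move=> g0 gae; apply/eqP; rewrite eq_le integral_ge0// andbT.
  rewrite ge0_integralTE//; apply/ge_ereal_sup => _ [h /= hg <-].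
  rewrite -integralT_nnsfun.
  rewrite (@ae_eq_integral _ _ _ mu setT (cst 0))// ?integral0//.
    exact/measurable_EFinP.
  apply: filterS gae => x gx _ /=; apply/eqP.
  by rewrite eq_le -{1}gx hg lee_fin fun_ge0.
move=> f0; rewrite integral_mkcond integralE.
have f0' : \forall x \ae mu, (f \_ D) x = 0.
  apply: filterS f0 => x fx; rewrite patchE.
  by case: ifPn => // /set_mem /fx.
by rewrite !ge0 ?sube0//; apply: filterS f0' => x;
  rewrite ?funeposE ?funenegE => ->; rewrite ?oppe0 maxxx.
Qed.

End UnmeasurableIntegrals.

(** The plane is exhausted by the squares [F n x F n] of an exhaustion of the line. The sets [F n]
    are taken increasing so that the index [maxn i j] captures both coordinates of a point. *)
Lemma plane_mu_sigma_finite (R : realType) : sigma_finite setT (@plane_mu R).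
Proof.
have /sigma_finiteP[F [FT Fnd Ffin]] := sigma_finiteT (@lebesgue_measure R).
exists (fun n => F n `*` F n) => [|n].
  apply/seteqP; split=> // -[x y] _.
  have [[i _ Fix] [j _ Fjy]] : (\bigcup_n F n) x /\ (\bigcup_n F n) y.
    by rewrite -FT.
  have Fsub k : (k <= maxn i j)%N -> F k `<=` F (maxn i j).
    by move=> /Fnd/subsetPset.
  exists (maxn i j) => //; split=> /=.
  - exact: Fsub (leq_maxl _ _) _ Fix.
  - exact: Fsub (leq_maxr _ _) _ Fjy.
have [mF Foo] := Ffin n; split; first exact: measurableX.
by rewrite /plane_mu product_measure1E// lte_mul_pinfty// ge0_fin_numE.
Qed.

(* The library makes [m1 \x m2] a sigma-finite measure only when m1 and m2 are
   subprobabilities; the product [plane_mu \x plane_mu] needs it here. *)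
HB.instance Definition _ (R : realType) := Measure.on (@plane_mu R).
HB.instance Definition _ (R : realType) :=
  Measure_isSigmaFinite.Build _ _ _ (@plane_mu R) (@plane_mu_sigma_finite R).

(** * The L^2 norm and inner product *)

Section SobolevNorm.
Context {R : realType}.
Variable Om : set (plane R).
Implicit Types (u v w f g phi n : plane R -> R).
Local Notation mu := (@plane_mu R).

Lemma restrict_lin (c : R) u v : (c *: u + v) \_ Om = c *: u \_ Om + v \_ Om.
Proof.
apply/funext => x; rewrite !patch_indic.
by transitivity ((c * u x + v x) * \1_Om x); rewrite // mulrDl -mulrA.
Qed.

Lemma restrictZ (c : R) u : (c *: u) \_ Om = c *: u \_ Om.
Proof.
apply/funext => x; rewrite !patch_indic.
by transitivity (c * u x * \1_Om x); rewrite // -mulrA.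
Qed.

Lemma restrict0 : (0 : plane R -> R) \_ Om = 0.
Proof. by apply/funext => x; rewrite !patch_indic; exact: mul0r. Qed.

Lemma restrictM u v : (fun x => u x * v x) \_ Om = (u \_ Om) \* (v \_ Om).
Proof.
by apply/funext => x; rewrite /patch/=; case: ifPn => // _; exact/esym/mulr0.
Qed.

Lemma lee12 : (1 <= 2%:E :> \bar R)%E.
Proof. by rewrite lee_fin ler1n. Qed.

Lemma L2_0 : L2 Om 0.
Proof.
rewrite /L2 /= restrict0.
by have [] := @Lfun_submod_closed _ _ _ mu 2%:E lee12.
Qed.

Lemma L2_lin (c : R) u v : L2 Om u -> L2 Om v -> L2 Om (c *: u + v).
Proof.
rewrite /L2 /= restrict_lin => Lu Lv.
by have [_] := @Lfun_submod_closed _ _ _ mu 2%:E lee12; apply.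
Qed.

Lemma L2Z (c : R) u : L2 Om u -> L2 Om (c *: u).
Proof. by move=> Lu; rewrite -[_ *: _]addr0; apply: L2_lin => //; exact: L2_0. Qed.

Lemma L2N u : L2 Om u -> L2 Om (- u).
Proof. by rewrite -scaleN1r; exact: L2Z. Qed.

Lemma L2D u v : L2 Om u -> L2 Om v -> L2 Om (u + v).
Proof. by rewrite -[u in u + v]scale1r; exact: L2_lin. Qed.

Lemma L2norm_ge0 u : (0 <= L2norm Om u)%E.
Proof. exact: Lnorm_ge0. Qed.

Lemma L2norm0 : L2norm Om 0 = 0%E.
Proof. by rewrite /L2norm restrict0 Lnorm0 // eqe pnatr_eq0. Qed.

Lemma L2norm_fin u : L2 Om u -> L2norm Om u \is a fin_num.
Proof.
by rewrite ge0_fin_numE ?L2norm_ge0// /L2 /= inE => /andP[_]; rewrite inE.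
Qed.

Lemma L2normZ (c : R) u : L2norm Om (c *: u) = (`|c|%:E * L2norm Om u)%E.
Proof.
rewrite /L2norm restrictZ unlock /=.
under eq_integral => x _ do
  rewrite /= !fctE normrM powRM// EFinM.
rewrite ge0_integral_scale ?powR_ge0//.
rewrite poweRM ?lee_fin ?powR_ge0//; last exact: integral_ge0.
by congr (_ * _)%E; rewrite poweR_EFin -powRrM mulfV ?pnatr_eq0// powRr1.
Qed.

Lemma L2inner_ae0 n w : ae_eq mu Om n 0 -> L2inner Om n w = 0.
Proof.
move=> n0; rewrite /L2inner /Rintegral integral_ae0//.
by apply: filterS n0 => x nx /nx; rewrite fctE => ->; rewrite mul0r.
Qed.

Lemma L2innerZl (c : R) u w : L2inner Om (c *: u) w = c * L2inner Om u w.
Proof.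
by rewrite -Rintegral_scale; apply: eq_Rintegral => x _; rewrite mulrA.
Qed.

Lemma L2innerZr (c : R) u w : L2inner Om u (c *: w) = c * L2inner Om u w.
Proof.
by rewrite -Rintegral_scale; apply: eq_Rintegral => x _; exact: mulrCA.
Qed.

Lemma L2inner0l w : L2inner Om 0 w = 0.
Proof. by rewrite -(scale0r 0) L2innerZl mul0r. Qed.

Lemma L2_integrableM u v : L2 Om u -> L2 Om v ->
  mu.-integrable setT (EFin \o (fun x => u x * v x) \_ Om).
Proof.
by move=> Lu Lv; apply/Lfun1_integrable; rewrite restrictM; exact: Lfun2_mul_Lfun1.
Qed.

Lemma L2inner_linr (c : R) f u v : L2 Om f -> L2 Om u -> L2 Om v ->
  L2inner Om f (c *: u + v) = c * L2inner Om f u + L2inner Om f v.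
Proof.
move=> Lf Lu Lv; rewrite -L2innerZr.
rewrite /L2inner !(@Rintegral_mkcond _ _ _ mu Om) -RintegralD//.
- apply: eq_Rintegral => x _; rewrite !patch_indic.
  by rewrite -mulrDl -mulrDr.
- by apply: L2_integrableM => //; exact: L2Z.
- exact: L2_integrableM.
Qed.

(** Cauchy-Schwarz, as the case of Hölder's inequality with both exponents 2. *)
Lemma L2inner_le u v : L2 Om u -> L2 Om v ->
  (`|L2inner Om u v|%:E <= L2norm Om u * L2norm Om v)%E.
Proof.
move=> Lu Lv; have iuv := L2_integrableM Lu Lv.
rewrite /L2inner Rintegral_mkcond EFin_normr_Rintegral//.
apply: le_trans (le_abse_integral _ _ _) _ => //; first exact: measurable_int iuv.
rewrite restrictM -Lnorm1; apply: hoelder => //.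
- by move: Lu; rewrite /L2/= inE => /andP[]; rewrite inE.
- by move: Lv; rewrite /L2/= inE => /andP[]; rewrite inE.
- by rewrite [RHS]splitr !div1r.
Qed.

(** * Homogeneity of Sobolev norms and their comparison with the L^2 norm *)

Lemma weak_derivativesZ (c : R) m v (g : nat -> nat -> plane R -> R) :
  weak_derivatives Om m v g ->
  weak_derivatives Om m (c *: v) (fun i j => c *: g i j).
Proof.
move=> [g0 gd]; split=> [|i j ijm]; first by rewrite g0.
have [Lg wg] := gd _ _ ijm; split; first exact: L2Z.
by move=> phi tphi; rewrite !L2innerZl wg// mulrCA.
Qed.

Lemma slobodeckij_integrand_ge0 (sigma : R) w (z : plane R * plane R) :
  (0 <= ((w z.1 - w z.2) ^+ 2 / Defs.edist z.1 z.2 `^ (2 + 2 * sigma))%:E)%E.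
Proof. by rewrite lee_fin divr_ge0//; [exact: sqr_ge0|exact: powR_ge0]. Qed.

Lemma slobodeckij_sqr_ge0 sigma w : (0 <= slobodeckij_sqr Om sigma w)%E.
Proof.
by apply: integral_ge0 => z _; exact: slobodeckij_integrand_ge0.
Qed.

Lemma slobodeckij_sqrZ (c sigma : R) w :
  slobodeckij_sqr Om sigma (c *: w) = ((c ^+ 2)%:E * slobodeckij_sqr Om sigma w)%E.
Proof.
rewrite /slobodeckij_sqr -ge0_integral_scale; first last.
- by move=> z _; exact: slobodeckij_integrand_ge0.
- exact: sqr_ge0.
apply: eq_integral => z _; rewrite -EFinM.
by rewrite mulrA -exprMn mulrBr.
Qed.

Lemma sqrL2norm_ge0 u : (0 <= L2norm Om u ^+ 2)%E.
Proof. by rewrite mule_ge0 ?L2norm_ge0. Qed.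

Lemma sobolev_sqr_ge0 (t : R) (g : nat -> nat -> plane R -> R) : (0 <= sobolev_sqr Om t g)%E.
Proof.
rewrite /sobolev_sqr adde_ge0//.
  by do 2 (apply: sume_ge0 => ? _); exact: sqrL2norm_ge0.
by case: ifP => // _; apply: sume_ge0 => ? _; exact: slobodeckij_sqr_ge0.
Qed.

Lemma sobolev_sqrZ (c t : R) (g : nat -> nat -> plane R -> R) :
  sobolev_sqr Om t (fun i j => c *: g i j) = ((c ^+ 2)%:E * sobolev_sqr Om t g)%E.
Proof.
rewrite /sobolev_sqr ge0_muleDr; last 2 first.
- by do 2 (apply: sume_ge0 => ? _); exact: sqrL2norm_ge0.
- by case: ifP => // _; apply: sume_ge0 => ? _; exact: slobodeckij_sqr_ge0.
congr (_ + _)%E.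
  rewrite ge0_sume_distrr; last first.
    by move=> i _; apply: sume_ge0 => j _; exact: sqrL2norm_ge0.
  apply: eq_bigr => i _; rewrite ge0_sume_distrr; last first.
    by move=> j _; exact: sqrL2norm_ge0.
  apply: eq_bigr => j _; rewrite L2normZ !expe2 muleACA -EFinM.
  by rewrite -normrM -expr2 ger0_norm// sqr_ge0.
case: ifP => _; first by rewrite mule0.
rewrite ge0_sume_distrr; last by move=> i _; exact: slobodeckij_sqr_ge0.
by apply: eq_bigr => i _; rewrite slobodeckij_sqrZ.
Qed.

Lemma sobolev_norm_ge0 (t : R) v : (0 <= sobolev_norm Om t v)%E.
Proof. by apply: le_ereal_inf_tmp => _ [g _ ->]; exact: sqrte_ge0. Qed.

(** Scaling carries a family of weak derivatives of [w] to one of [k *: w], which bounds the infimum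
    from above; the factor [c^-1] applied to [c *: v] gives the other inequality. *)
Lemma sobolev_normZ (c t : R) v : c != 0 ->
  sobolev_norm Om t (c *: v) = (`|c|%:E * sobolev_norm Om t v)%E.
Proof.
have half (k : R) w : k != 0 ->
    (sobolev_norm Om t (k *: w) <= `|k|%:E * sobolev_norm Om t w)%E.
  move=> k0; rewrite /sobolev_norm -ereal_inf_pZl ?normr_gt0//.
  apply: le_ereal_inf_tmp => _ [_ [g wg ->] <-].
  apply: ereal_inf_lbound; exists (fun i j => k *: g i j).
    exact: weak_derivativesZ.
  by rewrite sobolev_sqrZ sqrteM ?lee_fin ?sqr_ge0//= sqrtr_sqr.
move=> c0; apply/eqP; rewrite eq_le half//=.
have := half c^-1 (c *: v); rewrite scalerK// normfV invr_eq0 => /(_ c0).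
by rewrite lee_pdivlMl ?normr_gt0.
Qed.

(** For every admissible family [g 0 0] is [v], so the term of order (0, 0) is the squared L^2 norm;
    all remaining terms are nonnegative. *)
Lemma L2norm_le_sobolev_norm (t : R) v : (L2norm Om v <= sobolev_norm Om t v)%E.
Proof.
apply: le_ereal_inf_tmp => _ [g [g0 _] ->].
rewrite -(gee0_abs (L2norm_ge0 v)) -sqrte_sqr lee_sqrt ?sobolev_sqr_ge0//.
rewrite /sobolev_sqr big_ord_recl /= big_mkcond big_ord_recl /= g0 -!addeA leeDl//.
have ge0 i j : (0 <= (if (i + j <= Num.truncn t)%N
    then L2norm Om (g i j) ^+ 2 else 0))%E.
  by case: ifP => // _; exact: sqrL2norm_ge0.
rewrite adde_ge0//; first by apply: sume_ge0 => i _; exact: (ge0 0).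
rewrite adde_ge0//; first by do 2 apply: sume_ge0 => ? _; exact: sqrL2norm_ge0.
by case: ifP => // _; apply: sume_ge0 => ? _; exact: slobodeckij_sqr_ge0.
Qed.

(** An infimum below [+oo] is taken over a nonempty set, so an admissible family exists, and its
    member of order (0, 0) is [v]. *)
Lemma sobolev_L2 (t : R) v : sobolev Om t v -> L2 Om v.
Proof.
move=> /ereal_inf_lt[_ [g [g0 gd] _] _].
by have [] := gd 0 0 (leq0n _); rewrite g0.
Qed.

Lemma ae_eq0_of_L2norm_eq0 v : L2 Om v -> L2norm Om v = 0%E -> ae_eq mu Om v 0.
Proof.
rewrite /L2/= inE => /andP[] /[!inE] mv _ v0.
have : (EFin \o v \_ Om) = \0%E %[ae mu].
  apply: Lnorm_eq0_eq0 v0; first exact/measurable_EFinP.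
  by rewrite lte_fin.
apply: (@filterS _ _ (ae_filter_ringOfSetsType (@plane_mu R))) => x /(_ I).
by rewrite /= => vx Omx; move: vx; rewrite /patch mem_set// => -[].
Qed.

Lemma sobolev_norm2_ae0 n : L2 Om n -> ae_eq mu Om n 0 -> sobolev_norm Om 2 n = 0%E.
Proof.
move=> Ln n0; apply/eqP; rewrite eq_le sobolev_norm_ge0 andbT.
(* Order (0, 0) must be [n] itself, by Leibniz equality; the zero function serves as every other
   derivative. *)
pose g i j := if (i + j == 0)%N then n else 0.
have L2g i j : L2norm Om (g i j) = 0%E.
  rewrite /g; case: ifP => _; last exact: L2norm0.
  rewrite /L2norm unlock (@integral_ae0 _ _ _ _ setT) ?poweR0r ?invr_neq0//.
  apply: filterS n0 => x nx _ /=; have -> : (n \_ Om) x = 0.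
    by rewrite /patch; case: ifPn => // /set_mem/nx.
  by rewrite normr0 powR0.
apply: ereal_inf_lbound; exists g.
  split=> // i j _; rewrite /g; case: ifPn => ij.
    split=> // phi _; move: ij; rewrite addn_eq0 => /andP[/eqP-> /eqP->].
    by rewrite expr0 mul1r.
  split; first exact: L2_0.
  by move=> phi _; rewrite L2inner_ae0// L2inner0l mulr0.
rewrite /sobolev_sqr big1; last first.
  by move=> i _; rewrite big1// => j _; rewrite L2g expe2 mule0.
(* The order 2 is an integer, so there is no Slobodeckij term. *)
rewrite natrK eqxx adde0 sqrte0//.
Qed.

(** * Test functions and the space H^2_0 *)

Lemma test_function0 : test_function Om 0.
Proof.
have supp0 : [set x | (0 : plane R -> R) x != 0] = set0.
  by apply/seteqP; split=> x //=; rewrite eqxx.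
split; [|by rewrite supp0 closure0; exact: compact0|by rewrite supp0 closure0].
have d0 (l : seq bool) :
    foldr (fun b : bool => if b then d1 else d2) (0 : plane R -> R) l = 0.
  elim: l => //= b l ->.
  by case: b; apply/funext => x; rewrite /d1 /d2 derive_cst.
by move=> l x; rewrite d0; exact: differentiable_cst.
Qed.

Lemma test_functionZ (c : R) phi : c != 0 -> test_function Om phi ->
  test_function Om (c *: phi).
Proof.
move=> c0 [sm cpt sub].
have suppZ : [set x | (c *: phi) x != 0] = [set x | phi x != 0].
  by apply/seteqP; split=> x /=; rewrite fctE scaler_eq0 (negbTE c0).
split; rewrite ?suppZ//.
have dZ (l : seq bool) :
    foldr (fun b : bool => if b then d1 else d2) (c *: phi) l =
    c *: foldr (fun b : bool => if b then d1 else d2) phi l.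
  elim: l => //= b l ->.
  by case: b; apply/funext => x; rewrite /d1 /d2 deriveZ//; exact/diff_derivable/sm.
by move=> l x; rewrite dZ; exact/differentiableZ/sm.
Qed.

(** The test function 0 approximates [n] with error 0. This places the null defects of
    almost-everywhere linear operators in V, where the mesh norm and the form can be applied to
    them. *)
Lemma H20_ae0 n : L2 Om n -> ae_eq mu Om n 0 -> H20 Om n.
Proof.
move=> Ln n0; split; first by rewrite /sobolev/= sobolev_norm2_ae0// ltry.
move=> e e0; exists 0; first exact: test_function0.
by rewrite subr0 sobolev_norm2_ae0// lte_fin.
Qed.

Lemma H20_0 : H20 Om 0.
Proof. by apply: H20_ae0; [exact: L2_0|apply: ae_eq_refl]. Qed.

Lemma H20Z (c : R) v : H20 Om v -> H20 Om (c *: v).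
Proof.
have [->|c0] := eqVneq c 0; first by move=> _; rewrite scale0r; exact: H20_0.
move=> [sv cv]; split.
  rewrite /sobolev /= sobolev_normZ// lte_mul_pinfty// ?lee_fin//.
move=> e e0; have [|phi tphi] := cv (`|c|^-1 * e).
  by rewrite mulr_gt0// invr_gt0 normr_gt0.
exists (c *: phi); first exact: test_functionZ.
rewrite -scalerBr sobolev_normZ// -lte_pdivlMl ?normr_gt0//.
Qed.

Lemma H20_L2 v : H20 Om v -> L2 Om v.
Proof. by move=> [] /sobolev_L2. Qed.

(** Makes the solution operator applicable to an L^2 right-hand side; the L^2 norm of [f] is a bound
    for the functional. *)
Lemma L2inner_Hm2 f : L2 Om f -> Hm2 Om (L2inner Om f).
Proof.
move=> Lf; split=> [c u v /H20_L2 Lu /H20_L2 Lv|]; first exact: L2inner_linr.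
exists (fine (L2norm Om f)) => v /H20_L2 Lv; rewrite fineK ?L2norm_fin//.
apply: le_trans (L2inner_le Lf Lv) _.
by apply: lee_wpmul2l; [exact: L2norm_ge0|exact: L2norm_le_sobolev_norm].
Qed.

End SobolevNorm.

(** * The sum space, its norm and its form on a fixed mesh *)

Section NonconformingEstimates.
Context {R : realType}.
Variables (Om : set (plane R)) (Vh : set (plane R -> R)).
Variables (N : (plane R -> R) -> R) (b : (plane R -> R) -> (plane R -> R) -> R).
Local Notation mu := (@plane_mu R).
Local Notation V := (H20 Om).
Local Notation W := (set_sum V Vh).
Hypotheses (Vh_sub : Defs.subspace Vh) (Vh_L2 : Vh `<=` L2 Om).
Hypothesis N_norm : norm_on Om W N.
Hypothesis b_bilin : symmetric_bilinear_on W b.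
Variable M : R.
Hypothesis b_bounded : forall u v, W u -> W v -> `|b u v| <= M * N u * N v.
Implicit Types (u v w chi : plane R -> R) (X Y : set (plane R -> R)).

Lemma subspaceZ X (c : R) u : Defs.subspace X -> X u -> X (c *: u).
Proof. by move=> [X0 XL] Xu; rewrite -[_ *: _]addr0; exact: XL. Qed.

Lemma subspaceN X u : Defs.subspace X -> X u -> X (- u).
Proof. by rewrite -scaleN1r; exact: subspaceZ. Qed.

Lemma subspaceB X u v : Defs.subspace X -> X u -> X v -> X (u - v).
Proof.
by move=> sX Xu Xv; rewrite -[u]scale1r; apply: sX.2 => //; exact: subspaceN.
Qed.

Lemma sum_conforming u : V u -> W u.
Proof. by move=> Vu; exists u, 0; split=> //; [exact: Vh_sub.1|rewrite addr0]. Qed.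

Lemma sum_discrete v : Vh v -> W v.
Proof. by move=> Vv; exists 0, v; split=> //; [exact: H20_0|rewrite add0r]. Qed.

Lemma sum_spaceZ (c : R) w : W w -> W (c *: w).
Proof.
move=> [u [v [Vu Vv ->]]]; exists (c *: u), (c *: v).
by split; [exact: H20Z|exact: subspaceZ|rewrite scalerDr].
Qed.

Lemma sum_spaceN w : W w -> W (- w).
Proof. by rewrite -scaleN1r; exact: sum_spaceZ. Qed.

Lemma sum_conformingB u v : V u -> Vh v -> W (u - v).
Proof. by move=> Vu Vv; exists u, (- v); split=> //; exact: subspaceN. Qed.

Lemma sum_discreteB v u : Vh v -> V u -> W (v - u).
Proof. by move=> Vv Vu; rewrite -opprB; apply/sum_spaceN/sum_conformingB. Qed.

Lemma mesh_norm_ge0 w : W w -> 0 <= N w.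
Proof. by case: N_norm => + _ _ _; apply. Qed.

Lemma mesh_norm_ae0 w : W w -> ae_eq mu Om w 0 -> N w = 0.
Proof. by case: N_norm => _ N0 _ _ /N0 ->. Qed.

Lemma mesh_normZ (c : R) w : W w -> N (c *: w) = `|c| * N w.
Proof. by case: N_norm => _ _ + _; apply. Qed.

Lemma mesh_norm_leB u v : W u -> W v -> N (u - v) <= N u + N v.
Proof.
move=> Wu Wv; have [_ _ _ tri] := N_norm.
apply: (le_trans (tri _ _ Wu (sum_spaceN Wv))).
by rewrite -scaleN1r mesh_normZ// normrN1 mul1r.
Qed.

Lemma formD u v w : W u -> W v -> W w -> b (u + v) w = b u w + b v w.
Proof. by move=> Wu Wv Ww; rewrite -[u in LHS]scale1r b_bilin.2// mul1r. Qed.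

Lemma form0 w : W w -> b 0 w = 0.
Proof.
move=> Ww; have W0 := sum_conforming (@H20_0 _ Om).
by apply: (@addrI _ (b 0 w)); rewrite -formD// !addr0.
Qed.

Lemma formZ (c : R) u w : W u -> W w -> b (c *: u) w = c * b u w.
Proof.
move=> Wu Ww; have W0 := sum_conforming (@H20_0 _ Om).
by rewrite -[c *: u]addr0 b_bilin.2// form0// addr0.
Qed.

Lemma formB u v w : W u -> W v -> W w -> b (u - v) w = b u w - b v w.
Proof.
by move=> Wu Wv Ww; rewrite -scaleN1r formD ?formZ ?mulN1r//; exact: sum_spaceZ.
Qed.

Lemma form_eq0 u v : W u -> W v -> N u * N v = 0 -> b u v = 0.
Proof.
move=> Wu Wv Nuv; apply/eqP; rewrite -normr_le0.
by apply: le_trans (b_bounded Wu Wv) _; rewrite -mulrA Nuv mulr0.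
Qed.

Lemma sup_nneg_ub (S : set R) (x delta : R) :
  sup_nneg S = delta%:E -> S x -> x <= delta.
Proof.
move=> Sd Sx; rewrite -lee_fin -Sd /sup_nneg le_max; apply/orP; right.
by apply: ereal_sup_ubound; exists x.
Qed.

Lemma linear_operator_ae0 X Y A u : X 0 -> linear_operator Om X Y A ->
  X u -> ae_eq mu Om u 0 -> ae_eq mu Om (A u) 0.
Proof.
move=> X0 [_ Aae Alin] Xu u0; apply: ae_eq_trans (Aae _ _ Xu X0 u0) _.
(* With coefficient -1 linearity reads [A 0 = - A 0 + A 0] almost everywhere, so [A 0] is null. *)
have := Alin (-1) 0 0 X0 X0.
rewrite scaler0 addr0 scaleN1r addNr.
exact.
Qed.

(* I_h and E_h are linear up to null functions only; [mesh_norm_ae0] makes such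
   functions invisible to N and b. *)
Lemma linear_operatorZ X Y A (c : R) u : X 0 -> linear_operator Om X Y A ->
  X u -> ae_eq mu Om (A (c *: u) - c *: A u) 0.
Proof.
move=> X0 linA Xu; have A0 := linear_operator_ae0 X0 linA X0 (ae_eq_refl _ _ _).
have [_ _ Alin] := linA.
have := Alin c u 0 Xu X0; rewrite addr0.
apply: filterS2 A0 => x A0x Ax Omx.
have {}Ax := Ax Omx; have {}A0x := A0x Omx.
have -> : (A (c *: u) - c *: A u) x = A (c *: u) x - c * A u x by [].
rewrite Ax (_ : (c *: A u + A 0) x = c * A u x + A 0 x)// A0x.
by rewrite addr0 subrr.
Qed.

(** Covers the functions that cannot be normalised in the H^s norm when a supremum over unit vectors
    is turned into a bound. *)
Lemma sobolev_norm_eq0_ae0 s u : V u -> sobolev_norm Om s u = 0%E ->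
  ae_eq mu Om u 0.
Proof.
move=> Vu u0; apply: ae_eq0_of_L2norm_eq0; first exact: H20_L2.
by apply/eqP; rewrite eq_le L2norm_ge0 andbT -u0 L2norm_le_sobolev_norm.
Qed.

(** * From the supremum in (P1) to a bound for every function *)

Section Interpolation.
Variables (s delta : R) (I : (plane R -> R) -> plane R -> R).
Hypothesis I_lin : linear_operator Om V Vh I.
Hypothesis P1 : sup_nneg [set x | exists v, [/\ V v, sobolev Om s v,
  sobolev_norm Om s v = 1%E & x = N (v - I v)]] = delta%:E.

Lemma interpolation_error u r : V u -> sobolev_norm Om s u = r%:E ->
  N (u - I u) <= delta * r.
Proof.
move=> Vu ur; have [IV _ _] := I_lin.
have r_ge0 : 0 <= r by rewrite -lee_fin -ur sobolev_norm_ge0.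
have WB v : V v -> W (v - I v) by move=> Vv; apply: sum_conformingB => //; exact: IV.
(* If [r] is 0, then [u] is null and so is [I u]; both have mesh norm 0. *)
have [r0|rn0] := eqVneq r 0.
  have u0 : ae_eq mu Om u 0 by apply: (@sobolev_norm_eq0_ae0 s); rewrite // ur r0.
  apply: le_trans (mesh_norm_leB _ _) _.
  - exact: sum_conforming.
  - exact/sum_discrete/IV.
  rewrite r0 mulr0 !mesh_norm_ae0 ?addr0//; last exact: sum_conforming.
    exact/sum_discrete/IV.
  by apply: linear_operator_ae0 I_lin _ u0 => //; exact: H20_0.
have r_gt0 : 0 < r by rewrite lt_neqAle eq_sym rn0.
pose w := r^-1 *: u; have Vw : V w by exact: H20Z.
have w1 : sobolev_norm Om s w = 1%E.
  by rewrite /w sobolev_normZ ?invr_eq0// ur ger0_norm ?invr_ge0// -EFinM mulVf.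
have Nw : N (w - I w) <= delta.
  by apply: sup_nneg_ub P1 _; exists w; split=> //; rewrite /sobolev/= w1 ltry.
pose n := I w - r^-1 *: I u.
have Vn : Vh (- n).
  apply: subspaceN => //; apply: subspaceB => //; first exact: IV.
  by apply: subspaceZ => //; exact: IV.
have Nn : N (- n) = 0.
  have Wn : W n by rewrite -[n]opprK; apply: sum_spaceN; exact: sum_discrete.
  rewrite -scaleN1r mesh_normZ// mesh_norm_ae0 ?mulr0//.
  by apply: linear_operatorZ I_lin _ => //; exact: H20_0.
(* Here [n] is the null defect in the homogeneity of [I]. The double sign gives the shape of a
   difference, ready for [mesh_norm_leB]. *)
have -> : u - I u = r *: ((w - I w) - - n).
  rewrite opprK /n addrA subrK scalerBr !scalerA mulfV// !scale1r.
  by [].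
rewrite mesh_normZ; last first.
  rewrite opprK /n addrA subrK; apply: sum_conformingB => //.
  by apply: subspaceZ => //; exact: IV.
rewrite ger0_norm// mulrC ler_wpM2r//.
apply: le_trans (mesh_norm_leB _ _) _; [exact: WB|exact: sum_discrete|].
by rewrite Nn addr0.
Qed.

End Interpolation.

(** * From the supremum in (P2)(c) to a bound for every pair of functions *)

Section Companion.
Variables (s delta : R) (E : (plane R -> R) -> plane R -> R).
Hypothesis E_lin : linear_operator Om Vh V E.
Hypothesis P2c : sup_nneg [set x | exists v chi, [/\ Vh v /\ N v = 1,
  V chi /\ sobolev Om s chi, sobolev_norm Om s chi = 1%E &
  x = `|b (v - E v) chi|]] = delta%:E.

(** Both arguments are normalised, [v] in the mesh norm and [chi] in the H^s norm. If either norm is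
    0, boundedness of the form makes both sides vanish. *)
Lemma companion_consistency v chi r : Vh v -> V chi ->
  sobolev_norm Om s chi = r%:E -> `|b (v - E v) chi| <= delta * N v * r.
Proof.
move=> Vv Vchi chir; have [EV _ _] := E_lin.
have r_ge0 : 0 <= r by rewrite -lee_fin -chir sobolev_norm_ge0.
have Wv := sum_discrete Vv; have Wchi := sum_conforming Vchi.
have WB z : Vh z -> W (z - E z) by move=> Vz; apply: sum_discreteB => //; exact: EV.
have [r0|rn0] := eqVneq r 0.
  rewrite form_eq0 ?normr0 ?r0 ?mulr0//; first exact: WB.
  rewrite [N chi]mesh_norm_ae0 ?mulr0//.
  by apply: (@sobolev_norm_eq0_ae0 s); rewrite // chir r0.
have [Nv0|Nvn0] := eqVneq (N v) 0.
  have v0 : ae_eq mu Om v 0 by have [_ N0 _ _] := N_norm; apply/N0.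
  rewrite form_eq0 ?normr0 ?Nv0 ?mulr0 ?mul0r//; first exact: WB.
  suff -> : N (v - E v) = 0 by rewrite mul0r.
  apply/eqP; rewrite eq_le mesh_norm_ge0 ?andbT; last exact: WB.
  apply: le_trans (mesh_norm_leB _ _) _ => //; first exact/sum_conforming/EV.
  rewrite Nv0 add0r mesh_norm_ae0//; first exact/sum_conforming/EV.
  by apply: linear_operator_ae0 E_lin _ v0 => //; exact: Vh_sub.1.
have r_gt0 : 0 < r by rewrite lt_neqAle eq_sym rn0.
have Nv_gt0 : 0 < N v by rewrite lt_neqAle eq_sym Nvn0 mesh_norm_ge0.
pose c := (N v)^-1; pose z := c *: v; pose psi := r^-1 *: chi.
have Vz : Vh z by exact: subspaceZ.
have Vpsi : V psi by exact: H20Z.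
have Wpsi := sum_conforming Vpsi.
have psi1 : sobolev_norm Om s psi = 1%E.
  by rewrite /psi sobolev_normZ ?invr_eq0// chir ger0_norm ?invr_ge0// -EFinM mulVf.
have z1 : N z = 1 by rewrite mesh_normZ// ger0_norm ?invr_ge0 ?mesh_norm_ge0// mulVf.
have : `|b (z - E z) psi| <= delta.
  apply: sup_nneg_ub P2c _; exists z, psi; split=> //; split=> //.
  by rewrite /sobolev/= psi1 ltry.
pose n := E z - c *: E v.
have n0 : ae_eq mu Om n 0.
  by apply: linear_operatorZ E_lin _ => //; exact: Vh_sub.1.
(* Membership comes from [n] being null and in L^2, through [H20_ae0]. *)
have Wn : W n.
  apply/sum_conforming/H20_ae0 => //.
  by apply: L2D; [exact/H20_L2/EV|exact/L2N/L2Z/H20_L2/EV].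
have -> : z - E z = c *: (v - E v) - n.
  by rewrite /n opprB scalerBr addrA subrK.
have WcB : W (c *: (v - E v)) by apply: sum_spaceZ; exact: WB.
rewrite [b (_ - n) _]formB//.
rewrite [b n _]form_eq0 ?(mesh_norm_ae0 Wn) ?mul0r// subr0 formZ//; last exact: WB.
(* Linearity is stated in the first argument, so symmetry brings [psi] there and back. *)
rewrite (b_bilin.1 _ _ (WB _ Vv) Wpsi) formZ//; last exact: WB.
rewrite (b_bilin.1 _ _ Wchi (WB _ Vv)) 2!normrM.
rewrite (ger0_norm (_ : 0 <= c)) ?invr_ge0 ?mesh_norm_ge0//.
rewrite (ger0_norm (_ : 0 <= r^-1)) ?invr_ge0//.
by rewrite ler_pdivrMl// ler_pdivrMl// mulrCA [r * _]mulrC mulrA [N v * delta]mulrC.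
Qed.

End Companion.

(** * The error estimate on a fixed mesh *)

Section ErrorEstimate.
Variables (s delta1 delta2 delta4 alpha : R) (I E : (plane R -> R) -> plane R -> R).
Hypotheses (I_lin : linear_operator Om V Vh I) (E_lin : linear_operator Om Vh V E).
Hypothesis P1 : sup_nneg [set x | exists v, [/\ V v, sobolev Om s v,
  sobolev_norm Om s v = 1%E & x = N (v - I v)]] = delta1%:E.
Hypotheses (d2_ge0 : 0 <= delta2) (d4_ge0 : 0 <= delta4).
Hypothesis P2a : forall v, Vh v ->
  (L2norm Om (v - E v)%R <= (delta2 * dist_to N V v)%:E)%E.
Hypothesis P2c : sup_nneg [set x | exists v chi, [/\ Vh v /\ N v = 1,
  V chi /\ sobolev Om s chi, sobolev_norm Om s chi = 1%E &
  x = `|b (v - E v) chi|]] = delta4%:E.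
Hypotheses (alpha_gt0 : 0 < alpha) (M_gt0 : 0 < M).
Hypothesis b_coercive : forall v, Vh v -> alpha * N v ^+ 2 <= b v v.

(** The function 0 is a competitor in V, and nonnegativity of [N] bounds the set below, so the
    infimum is below each of its members. *)
Lemma dist_to_le v : Vh v -> dist_to N V v <= N v.
Proof.
move=> Vv; rewrite -[v in leRHS]subr0; apply: ge_inf; last first.
  by exists 0 => //; exact: H20_0.
by exists 0 => _ [z Vz <-]; apply: mesh_norm_ge0; exact: sum_discreteB.
Qed.

(** The triangle inequality through [I u] leaves the interpolation error and the discrete part
    [I u - uh]; for the latter [M] comes from boundedness and [alpha^-1] from coercivity. *)
Lemma nonconforming_error f u uh r l : L2 Om f -> V u -> Vh uh ->
  (forall v, V v -> b u v = L2inner Om f v) ->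
  (forall v, Vh v -> b uh v = L2inner Om f v) ->
  sobolev_norm Om s u = r%:E -> L2norm Om f = l%:E ->
  N (u - uh) <= delta1 * r + alpha^-1 * (M * (delta1 * r) + delta4 * r + delta2 * l).
Proof.
move=> Lf Vu Vuh bu buh ur fl.
have [IV _ _] := I_lin; have [EV _ _] := E_lin.
pose w := I u - uh; have Vw : Vh w by apply: subspaceB => //; exact: IV.
have [Wu Ww] := (sum_conforming Vu, sum_discrete Vw).
have [Wuh WEw] := (sum_discrete Vuh, sum_conforming (EV _ Vw)).
have WIu : W (u - I u) by apply: sum_conformingB => //; exact: IV.
have WuB : W (u - uh) by exact: sum_conformingB.
have WwB : W (w - E w) by apply: sum_discreteB => //; exact: EV.
have Iu_le : N (u - I u) <= delta1 * r by exact: interpolation_error P1 _ _ Vu ur.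
have Nw_ge0 : 0 <= N w by exact: mesh_norm_ge0.
(* Write [w = (u - uh) - (u - I u)]. The discrete equation gives [b uh w = (f, w)], and splitting
   [w = (w - E w) + E w] in [b u w] lets the continuous equation be tested with [E w]. *)
have energy : b w w = - b (u - I u) w + b (w - E w) u + L2inner Om f (E w - w).
  have wE : w = (u - uh) - (u - I u) by rewrite opprB addrC addrA subrK.
  set B := b (w - E w) u.
  rewrite {1}wE formB// formB// buh// addrC -addrA; congr (_ + _).
  rewrite -{1}[w](subrK (E w)) b_bilin.1; last 2 first.
  - exact: Wu.
  - by rewrite subrK.
  rewrite formD// -/B [b (E w) u]b_bilin.1// bu; last exact: EV.
  rewrite -[E w - w]addrC -[- w]scaleN1r L2inner_linr ?mulN1r//.
  - by rewrite -addrA [- _ + _]addrC.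
  - exact: Vh_L2.
  - exact/H20_L2/EV.
have residual : `|L2inner Om f (E w - w)| <= l * (delta2 * N w).
  have Ll : L2 Om (E w - w).
    by apply: L2D; [exact/H20_L2/EV|exact/L2N/Vh_L2].
  rewrite -lee_fin; apply: le_trans (L2inner_le Lf Ll) _.
  rewrite fl EFinM lee_wpmul2l//; first by rewrite -fl L2norm_ge0.
  rewrite -opprB -scaleN1r L2normZ normrN1 mul1e.
  apply: le_trans (P2a Vw) _; rewrite lee_fin ler_wpM2l//.
  exact: dist_to_le.
have Nw : N w <= alpha^-1 * (M * (delta1 * r) + delta4 * r + delta2 * l).
  rewrite ler_pdivlMl//.
  (* Coercivity controls the square of [N w], so one factor [N w] is to be cancelled; when it is 0,
     a nonnegative right-hand side suffices. *)
  have [->|Nw0] := eqVneq (N w) 0.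
    have r_ge0 : 0 <= r by rewrite -lee_fin -ur sobolev_norm_ge0.
    have l_ge0 : 0 <= l by rewrite -lee_fin -fl L2norm_ge0.
    have delta1r_ge0 : 0 <= delta1 * r by apply: le_trans Iu_le; exact: mesh_norm_ge0.
    by rewrite mulr0 !addr_ge0// mulr_ge0// ltW.
  have Nw_gt0 : 0 < N w by rewrite lt_neqAle eq_sym Nw0.
  rewrite -(ler_pM2r Nw_gt0) -mulrA -expr2.
  apply: le_trans (b_coercive Vw) _; rewrite energy.
  apply: le_trans (ler_norm _) _.
  apply: le_trans (ler_normD _ _) _; rewrite [leRHS]mulrDl; apply: lerD; last first.
    by rewrite -mulrA mulrCA.
  apply: le_trans (ler_normD _ _) _; rewrite [leRHS]mulrDl normrN; apply: lerD.
    apply: le_trans (b_bounded WIu Ww) _.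
    by rewrite ler_wpM2r// ler_wpM2l// ltW.
  by rewrite mulrAC; apply: companion_consistency P2c _ _ _ Vw Vu ur.
have -> : u - uh = (u - I u) - - w by rewrite opprK /w addrA subrK.
apply: le_trans (mesh_norm_leB _ _) _ => //; first exact: sum_spaceN.
apply: lerD => //.
by rewrite -scaleN1r mesh_normZ// normrN1 mul1r.
Qed.

End ErrorEstimate.

End NonconformingEstimates.

(** * The estimate with a constant uniform in the mesh size *)

Theorem theorem2p6 (R : realType) (Om : set (plane R))
    (T : ((plane R -> R) -> R) -> plane R -> R)
    (p : nat) (Hs : set R) (Ph : R -> set (set (plane R)))
    (Vh : R -> set (plane R -> R))
    (ah : R -> (plane R -> R) -> (plane R -> R) -> R)
    (nh : R -> (plane R -> R) -> R)
    (Th : R -> (plane R -> R) -> plane R -> R)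
    (k : nat) (s : R)
    (Ih Eh : R -> (plane R -> R) -> plane R -> R)
    (delta1 : R -> R -> R) (delta2 delta4 : R -> R)
    (hOm : bounded_lipschitz_domain Om)
    (hT : solution_operator Om T)
    (hdisc : discretization Om p Hs Ph Vh ah nh Th)
    (hs : 2 <= s)
    (hreg : exists2 C : R, 0 < C & forall g, sobolev Om k%:R g ->
       sobolev Om s (T (L2inner Om g)) /\
       (sobolev_norm Om s (T (L2inner Om g)) <=
          C%:E * sobolev_norm Om k%:R g)%E)
    (hI : forall h, Hs h -> linear_operator Om (H20 Om) (Vh h) (Ih h))
    (hE : forall h, Hs h -> linear_operator Om (Vh h) (H20 Om) (Eh h))
    (hdelta : forall h, Hs h ->
       [/\ 0 <= delta1 h s, 0 <= delta2 h & 0 <= delta4 h])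
    (P1 : forall h, Hs h ->
       sup_nneg [set x | exists v, [/\ H20 Om v, sobolev Om s v,
                           sobolev_norm Om s v = 1%E &
                           x = nh h (v - Ih h v)]]
         = (delta1 h s)%:E)
    (P2a : forall h, Hs h -> forall v, Vh h v ->
       (L2norm Om (v - Eh h v)%R <=
          (delta2 h * dist_to (nh h) (H20 Om) v)%:E)%E)
    (P2c : forall h, Hs h ->
       sup_nneg [set x | exists v chi, [/\ Vh h v /\ nh h v = 1,
                           H20 Om chi /\ sobolev Om s chi,
                           sobolev_norm Om s chi = 1%E &
                           x = `|ah h (v - Eh h v) chi|]]
         = (delta4 h)%:E) :
  exists2 C : R, 0 < C & forall h, Hs h -> forall f, sobolev Om k%:R f ->
    ((nh h (T (L2inner Om f) - Th h f)%R)%:E <=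
       (C * (delta1 h s + delta2 h + delta4 h))%:E * sobolev_norm Om k%:R f)%E.
Proof.
have [C C_gt0 reg] := hreg.
case: hdisc => _ _ fes Nnorm bbil [M M_gt0 bbd] [alpha alpha_gt0 coer] conf dsol _.
(* The fixed-mesh bound with [r <= C * phi], [l <= phi] and each delta replaced by the sum of the
   three. The final 1 comes from the [delta2] term, where the L^2 norm of [f] is at most its H^k
   norm. *)
pose K := C + alpha^-1 * (M * C + C + 1).
exists K => [|h hh f fk].
  by rewrite addr_gt0// mulr_gt0 ?invr_gt0// !addr_gt0// mulr_gt0.
have [VhS VhL2 _] := fes h hh; have [d1_ge0 d2_ge0 d4_ge0] := hdelta h hh.
have Lf := sobolev_L2 fk; have [us u_le] := reg f fk.
have [Vu a_u _] := hT _ (L2inner_Hm2 Lf); set u := T (L2inner Om f) in us u_le Vu a_u *.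
have [Vuh b_uh _] := dsol h hh f Lf.
have fin t v : sobolev Om t v -> sobolev_norm Om t v = (fine (sobolev_norm Om t v))%:E.
  by move=> sv; rewrite fineK// ge0_fin_numE// sobolev_norm_ge0.
have fE := fin _ _ fk; have uE := fin _ _ us.
set phi := fine (sobolev_norm Om k%:R f) in fE; set r := fine (sobolev_norm Om s u) in uE.
have lE : L2norm Om f = (fine (L2norm Om f))%:E by rewrite fineK// L2norm_fin.
set l := fine (L2norm Om f) in lE.
have r_le : r <= C * phi by rewrite -lee_fin EFinM -uE -fE.
have l_le : l <= phi by rewrite -lee_fin -fE -lE L2norm_le_sobolev_norm.
have phi_ge0 : 0 <= phi by rewrite -lee_fin -fE sobolev_norm_ge0.
(* On V the discrete form agrees with the biharmonic one, so [u] also satisfies the continuous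
   equation for [ah h]. *)
have bu v : H20 Om v -> ah h u v = L2inner Om f v.
  by move=> Vv; rewrite conf// a_u.
rewrite fE -EFinM lee_fin.
have := nonconforming_error VhS VhL2 (Nnorm h hh) (bbil h hh) (bbd h hh)
  (hI h hh) (hE h hh) (P1 h hh) d2_ge0 d4_ge0 (P2a h hh) (P2c h hh)
  alpha_gt0 M_gt0 (coer h hh) Lf Vu Vuh bu b_uh uE lE.
move=> /le_trans; apply; set d1 := delta1 h s; set d2 := delta2 h; set d4 := delta4 h.
have Cphi_ge0 : 0 <= C * phi by rewrite mulr_ge0// ltW.
have d1r : d1 * r <= (d1 + d2 + d4) * (C * phi).
  by apply: le_trans (ler_wpM2l _ r_le) _ => //; rewrite ler_wpM2r// -addrA lerDl addr_ge0.
have d4r : d4 * r <= (d1 + d2 + d4) * (C * phi).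
  by apply: le_trans (ler_wpM2l _ r_le) _ => //; rewrite ler_wpM2r// lerDr addr_ge0.
have d2l : d2 * l <= (d1 + d2 + d4) * phi.
  apply: le_trans (ler_wpM2l _ l_le) _ => //.
  by rewrite ler_wpM2r// addrAC lerDr addr_ge0.
have -> : K * (d1 + d2 + d4) * phi = (d1 + d2 + d4) * (C * phi) +
    alpha^-1 * (M * ((d1 + d2 + d4) * (C * phi)) + (d1 + d2 + d4) * (C * phi) +
      (d1 + d2 + d4) * phi) by rewrite /K; ring.
rewrite lerD// ler_wpM2l ?invr_ge0 ?(ltW alpha_gt0)//.
by rewrite !lerD// ler_wpM2l// ltW.
Qed.
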